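(* Let $b\in\mathbb{R}$, let $1<\alpha<2$, and let ${f:{}_{b}\mathbb{N}\to\mathbb{R}}$ be a function such that ${}_{b}\Delta^{\alpha}f(u)\ge 0$ for all $u\in{}_{b-(2-\alpha)}\mathbb{N}$ and $$f(b-1)\ge\frac{\alpha}{k+1}f(b)\ge 0\quad\text{for each } k\in\{0,1,2,\dots\}.$$ Then $-\nabla f(t)\ge 0$ for all $t\in{}_{b-1}\mathbb{N}$.
   Context: For a real number $c$, ${}_{c}\mathbb{N}=\{c,c-1,c-2,\dots\}$. $\nabla f(t)=f(t)-f(t-1)$, $\nabla^m=\nabla(\nabla^{m-1})$, $\sigma(t)=t+1$. The falling function is $x^{(\beta)}=\Gamma(x+1)/\Gamma(x+1-\beta)$, with the convention that division at a pole yields zero. The delta right fractional sum of order $\beta>0$ ending at $b$ is ${}_{b}\Delta^{-\beta}f(t)=\frac{1}{\Gamma(\beta)}\sum_{s=t+\beta}^{b}(s-\sigma(t))^{(\beta-1)}f(s)$, $t\in{}_{b-\beta}\mathbb{N}$. For noninteger $\alpha>0$ and $n=[\alpha]+1$ (here $n=2$) the delta right (Riemann) fractional difference is ${}_{b}\Delta^{\alpha}f(t)=(-1)^n\nabla^n\,{}_{b}\Delta^{-(n-\alpha)}f(t)$, $t\in{}_{b-(n-\alpha)}\mathbb{N}$. *)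

(* Defs.v *)
From HB Require Import structures.
From mathcomp Require Import all_boot all_order all_algebra.
From mathcomp Require Import all_classical all_reals all_analysis.

Set Implicit Arguments.
Unset Strict Implicit.
Unset Printing Implicit Defensive.
Import Order.TTheory GRing.Theory Num.Theory.
Import numFieldNormedType.Exports.
Local Open Scope classical_set_scope.
Local Open Scope ring_scope.

Definition lowerN (R : realType) (c : R) : set R :=
  [set t | exists k : nat, t = c - k%:R].

(* {a, a + 1, ..., b}, the range of a discrete sum from a to b (b - a an
   integer); empty when b < a. *)
Definition sum_range (R : realType) (a b : R) : set R :=
  [set s | (exists k : nat, s = a + k%:R) /\ s <= b].

Definition nabla (R : realType) (f : R -> R) (t : R) : R := f t - f (t - 1).

Definition euler_integral (R : realType) (x : R) : R :=
  \int[lebesgue_measure]_(t in `]0, +oo[) (t `^ (x - 1) * expR (- t)).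

(* With n the least natural number such that 0 < x + n, this is
   Gamma (x + n) / (x (x + 1) ... (x + n - 1)), and n = 0 when 0 < x. *)
Definition Gamma (R : realType) (x : R) : R :=
  let n := Num.truncn (1 - x) in
  euler_integral (x + n%:R) / \prod_(i < n) (x + i%:R).

(* Since 0^-1 = 0, Gamma takes the value 0 at its poles, so that dividing by
   Gamma at a pole yields 0. *)
Lemma Gamma_pole (R : realType) (m : nat) : Gamma (- m%:R : R) = 0.
Proof.
rewrite /Gamma opprK -(natrD _ 1) natrK add1n /=.
by rewrite big_ord_recr /= addNr mulr0 invr0 mulr0.
Qed.

Definition falling (R : realType) (x beta : R) : R :=
  Gamma (x + 1) / Gamma (x + 1 - beta).

Definition sigma (R : realType) (t : R) : R := t + 1.

Definition delta_right_sum (R : realType) (b beta : R) (f : R -> R) (t : R)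
    : R :=
  (Gamma beta)^-1 *
    \sum_(s \in sum_range (t + beta) b) (falling (s - sigma t) (beta - 1) * f s).

Definition delta_right_diff (R : realType) (b alpha : R) (f : R -> R) (t : R)
    : R :=
  let n := (Num.truncn alpha).+1 in
  (-1) ^+ n * iter n (@nabla R) (delta_right_sum b (n%:R - alpha) f) t.

(* Main.v *)
(* Put [g j = f (b - j)], [nu = 2 - alpha] and [d j = g j - g (j - 1)]
   ([d 0 = g 0]). By the functional equation of [Gamma], the fractional sum at
   [b - nu - m] is the convolution of [g] with the coefficients [w] of
   [(1 - z)^(- nu)], so the fractional difference there is the coefficient of
   [z^(m + 2)] in [(1 - z)^(alpha - 1) * \sum_j d j z^j]. Since
   [0 < alpha - 1 < 1], every coefficient of [(1 - z)^(alpha - 1)] but the first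
   is negative, so the hypothesis bounds [d (m + 2)] below by a nonnegative
   combination of [d 0, ..., d (m + 1)], and [0 <= d j] follows by strong
   induction. *)
Require Import Defs.
From mathcomp Require Import all_boot all_order all_algebra.
From mathcomp Require Import all_classical all_reals all_analysis.
From mathcomp Require Import measurable_realfun ring lra.
Set Implicit Arguments.
Unset Strict Implicit.
Unset Printing Implicit Defensive.
Import Order.TTheory GRing.Theory Num.Theory.
Import numFieldNormedType.Exports.
Local Open Scope classical_set_scope.
Local Open Scope ring_scope.

(** * Euler's integral: convergence, positivity and functional equation *)

Lemma measurable_gamma_integrand (R : realType) (x : R) (D : set R) :
  measurable_fun D (fun t : R => t `^ x * expR (- t)).
Proof.
apply/measurable_funTS/measurable_funM.
  exact: measurable_powR.
apply: (measurableT_comp (@measurable_expR R)).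
exact: oppr_measurable.
Qed.

Lemma continuous_expRN (R : realType) : continuous (fun t : R => expR (- t)).
Proof.
move=> t; apply: (@continuous_comp _ _ _ -%R expR).
  exact: oppr_continuous.
exact: continuous_expR.
Qed.

Lemma continuous_powR (R : realType) (x t : R) : 0 < t ->
  {for t, continuous (fun t : R => t `^ x)}.
Proof.
move=> t0; apply/differentiable_continuous/derivable1_diffP.
by apply: derivable_powR; rewrite in_itv/= t0.
Qed.

Lemma segment_gamma_parts (R : realType) (x a b : R) : 0 < a -> a < b ->
  (\int[lebesgue_measure]_(t in `[a, b]) (t `^ x * expR (- t))%:E =
   (a `^ x * expR (- a) - b `^ x * expR (- b))%:E +
   x%:E * \int[lebesgue_measure]_(t in `[a, b])
            (t `^ (x - 1) * expR (- t))%:E)%E.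
Proof.
move=> a0 ab.
have itv_gt0 t : t \in `[a, b] -> 0 < t.
  by rewrite in_itv/= => /andP[at_ _]; exact: lt_le_trans at_.
have itv_oo_gt0 t : t \in `]a, b[ -> 0 < t.
  by move=> /subset_itv_oo_cc; exact: itv_gt0.
have powR_within y : {within `[a, b], continuous (fun t : R => t `^ y)}.
  apply: continuous_in_subspaceT => t /set_mem /= tab.
  exact/continuous_powR/itv_gt0.
have b0 := lt_trans a0 ab.
rewrite (@integration_by_parts R (fun t => t `^ x) (fun t => - expR (- t))
  (fun t => x * t `^ (x - 1)) (fun t => expR (- t))) //; first last.
- move=> t _; rewrite derive1E derive_val.
  by rewrite mulrN1 opprK.
- split.
  + move=> t _; apply: derivableN; exact: ex_derive.
  + by apply: cvg_at_right_filter; apply: cvgN; exact: continuous_expRN.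
  + by apply: cvg_at_left_filter; apply: cvgN; exact: continuous_expRN.
- by apply: continuous_subspaceT => t; exact: continuous_expRN.
- by move=> t tab; rewrite powR_derive1// in_itv/= itv_oo_gt0.
- split.
  + by move=> t tab; apply: derivable_powR; rewrite in_itv/= itv_oo_gt0.
  + by apply: cvg_at_right_filter; exact: continuous_powR.
  + by apply: cvg_at_left_filter; exact: continuous_powR.
- move=> t; apply: cvgM; first exact: cvg_cst.
  exact: powR_within.
congr (_ + _)%E; first by congr EFin; ring.
rewrite [X in (- X)%E](_ : _ = (- x)%:E *
    \int[lebesgue_measure]_(t in `[a, b]) (t `^ (x - 1) * expR (- t))%:E)%E.
  by rewrite EFinN mulNe oppeK.
rewrite -integralZl//; last first.
  apply: continuous_compact_integrable; first exact: segment_compact.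
  move=> t; apply: cvgM; first exact: powR_within.
  by apply: continuous_subspaceT => s; exact: continuous_expRN.
by apply: eq_integral => t _; rewrite /= -EFinM; congr EFin; ring.
Qed.

Lemma powR_expRN_le (R : realType) (x t : R) : 0 < x -> 0 <= t ->
  t `^ x * expR (- t) <= (2 * x) `^ x * expR (- (t / 2)).
Proof.
move=> x0 t0; have x20 : 0 < 2 * x by rewrite mulr_gt0.
have -> : - t = - (t / 2) - t / 2 by lra.
rewrite expRD mulrA ler_pM2r ?expR_gt0// expRN ler_pdivrMr ?expR_gt0//.
have -> : t / 2 = t / (2 * x) * x by field; rewrite gt_eqF.
rewrite expRM.
have -> : t `^ x = (2 * x) `^ x * (t / (2 * x)) `^ x.
  by rewrite -powRM ?divr_ge0 ?(ltW x20)// mulrC divfK// gt_eqF.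
rewrite ler_pM2l ?powR_gt0//.
apply: ge0_ler_powR; rewrite ?nnegrE ?divr_ge0 ?expR_ge0 ?(ltW x20) ?(ltW x0)//.
by apply: le_trans (expR_ge1Dx _); rewrite lerDr.
Qed.

Lemma powR_expRN_cvgy (R : realType) (x : R) : 0 < x ->
  t `^ x * expR (- t) @[t --> +oo] --> 0.
Proof.
move=> x0; apply: (@squeeze_cvgr _ _ _ _ (cst 0)
    (fun t => (2 * x) `^ x * expR (- (t / 2)))).
- near=> t; rewrite mulr_ge0 ?powR_ge0 ?expR_ge0//=.
  by apply: powR_expRN_le.
- exact: cvg_cst.
- rewrite -[X in _ --> X](mulr0 ((2 * x) `^ x)); apply: cvgM.
    exact: cvg_cst.
  apply: (@cvg_comp _ _ _ (fun t : R => t / 2) (fun t => expR (- t)) _ +oo).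
    by apply: gt0_cvgMly => //; exact: cvg_id.
  exact: cvgr_expR.
Unshelve. all: by end_near. Qed.

Lemma powR_expRN_cvg0 (R : realType) (x : R) : 0 < x ->
  t `^ x * expR (- t) @[t --> 0^'+] --> 0.
Proof.
move=> x0; rewrite -[X in _ --> X](mul0r (expR (- 0))); apply: cvgM.
  exact: powR_cvg0.
by apply: cvg_at_right_filter; exact: continuous_expRN.
Qed.

(* [euler_integral x] is the finite part of [gamma_int x]; in extended reals the
   functional equation [gamma_intD1] precedes, and yields, integrability. *)
Definition gamma_int (R : realType) (x : R) : \bar R :=
  (\int[lebesgue_measure]_(t in `]0%R, +oo[) (t `^ (x - 1) * expR (- t))%:E)%E.

(** Monotone convergence along an exhaustion of the half-line; the right end [n.+2] makes the
    segment nondegenerate already at [n = 0]. *)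
Lemma gamma_segment_cvg (R : realType) (x : R) :
  (\int[lebesgue_measure]_(t in `[(n.+1%:R^-1)%R, n.+2%:R%R])
      (t `^ (x - 1) * expR (- t))%:E)%E @[n --> \oo] --> gamma_int x.
Proof.
rewrite /gamma_int.
have -> : `]0%R, +oo[%classic =
    \bigcup_n `[(n.+1%:R : R)^-1, n.+2%:R]%classic.
  apply/seteqP; split => t /=; rewrite in_itv/= ?andbT.
    (* Then [n.+1] exceeds both [t] and [t^-1]. *)
    move=> t0; exists (maxn (Num.truncn t) (Num.truncn t^-1)) => //=.
    rewrite in_itv/= invf_ple ?posrE//; apply/andP; split.
      apply: le_trans (ltW (truncnS_gt _)) _.
      by rewrite ler_nat ltnS leq_maxr.
    apply: le_trans (ltW (truncnS_gt _)) _.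
    by rewrite ler_nat ltnS leqW// leq_maxl.
  by case=> n _ /=; rewrite in_itv/= => /andP[+ _]; exact: lt_le_trans.
apply: ge0_nondecreasing_set_cvg_integral => //.
- move=> m n mn; apply/subsetPset => t /=; rewrite !in_itv/= => /andP[mt tm].
  apply/andP; split.
    by apply: le_trans mt; rewrite lef_pV2 ?posrE// ler_nat ltnS.
  by apply: le_trans tm _; rewrite ler_nat !ltnS.
- by move=> n; apply/measurable_EFinP; exact: measurable_gamma_integrand.
- by move=> n t _; rewrite lee_fin mulr_ge0 ?powR_ge0 ?expR_ge0.
Qed.

Lemma gamma_int_ge0 (R : realType) (x : R) : (0 <= gamma_int x)%E.
Proof.
by apply: integral_ge0 => t _; rewrite lee_fin mulr_ge0 ?powR_ge0 ?expR_ge0.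
Qed.

(** The limit of [segment_gamma_parts] along these segments: the boundary terms vanish at both ends
    because [0 < x]. *)
Lemma gamma_intD1 (R : realType) (x : R) : 0 < x ->
  gamma_int (x + 1) = (x%:E * gamma_int x)%E.
Proof.
move=> x0; pose h (t : R) := t `^ x * expR (- t).
have an0 n : 0 < (n.+1%:R : R)^-1 by rewrite invr_gt0.
have ab n : (n.+1%:R : R)^-1 < n.+2%:R.
  by rewrite invf_plt ?posrE// (lt_le_trans (_ : _ < 1)) ?ler1n// invf_lt1 ?ltr1n.
have lim1 := @gamma_segment_cvg R (x + 1).
have hb : (h n.+1%:R^-1 - h n.+2%:R)%:E @[n --> \oo] --> 0%:E.
  apply: cvg_EFin; first by exact: nearW.
  rewrite -[X in _ --> X](subr0 0); apply: cvgB.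
    apply: ((cvg_at_rightP _ _ _).1 (powR_expRN_cvg0 x0)); split => //.
    exact: cvg_harmonic.
  apply: (cvg_comp _ _ _ (powR_expRN_cvgy x0)).
  rewrite (cvg_shiftS (fun n => n.+1%:R : R)) (cvg_shiftS (fun n => n%:R : R)).
  exact: cvgr_idn.
have lim2 := cvgeZl (erefl : x%:E \is a fin_num) (@gamma_segment_cvg R x).
rewrite -[RHS]add0e; apply: (cvg_unique _ lim1) => //.
rewrite addrK.
rewrite (funext (fun n => segment_gamma_parts x (an0 n) (ab n))).
exact: cvgeD hb lim2.
Qed.

Lemma gamma_int_fin_num (R : realType) (x : R) : 0 < x ->
  gamma_int x \is a fin_num.
Proof.
(* At [x + 1] the exponent is [x > 0], so [powR_expRN_le] applies; the functional equation then
   brings finiteness down to [x]. *)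
move=> x0; have : (gamma_int (x + 1) < +oo)%E.
  (* The density of rate [2^-1] is [2^-1 * expR (- (t / 2))]; the factor [2] cancels the rate. *)
  pose C := 2 * (2 * x) `^ x : R.
  have C0 : 0 <= C by rewrite mulr_ge0 ?powR_ge0.
  apply: (@le_lt_trans _ _ (\int[lebesgue_measure]_(t in [set: R])
      (C%:E * (exponential_pdf 2^-1 t)%:E)%E)%E).
    apply: (@le_trans _ _ (\int[lebesgue_measure]_(t in `]0%R, +oo[)
        (C%:E * (exponential_pdf 2^-1 t)%:E)%E)%E).
      apply: ge0_le_integral => //.
      - by move=> t _; rewrite lee_fin mulr_ge0 ?powR_ge0 ?expR_ge0.
      - by apply/measurable_EFinP; exact: measurable_gamma_integrand.
      - apply/measurable_EFinP/measurable_funM => //.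
        by apply/measurable_funTS; exact: measurable_exponential_pdf.
      - move=> t /=; rewrite in_itv/= andbT => t0.
        rewrite addrK -EFinM lee_fin (exponential_pdfE _ (ltW t0)) /C.
        apply: le_trans (powR_expRN_le x0 (ltW t0)) _.
        rewrite mulNr (mulrC 2^-1 t) [leRHS](_ : _ = (2 * x) `^ x * expR (- (t / 2)))//.
        by field.
    apply: ge0_subset_integral => //.
      apply/measurable_EFinP/measurable_funM => //.
      exact: measurable_exponential_pdf.
    by move=> t _; rewrite -EFinM lee_fin mulr_ge0// exponential_pdf_ge0.
  rewrite ge0_integralZl//.
  - by rewrite integral_exponential_pdf// mule1 ltry.
  - by apply/measurable_EFinP; exact: measurable_exponential_pdf.
  - by move=> t _; rewrite lee_fin exponential_pdf_ge0.
rewrite gamma_intD1// ge0_fin_numE ?gamma_int_ge0//.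
rewrite !ltey; apply: contra => /eqP ->.
by rewrite gt0_muley// lte_fin.
Qed.

Lemma euler_integral_gt0 (R : realType) (x : R) : 0 < x -> 0 < euler_integral x.
Proof.
move=> x0; apply: fine_gt0; rewrite -/(gamma_int x).
rewrite -ge0_fin_numE ?gamma_int_ge0// gamma_int_fin_num// andbT.
apply: (@lt_le_trans _ _ (\int[lebesgue_measure]_(t in `[1%R, 2%R])
    cst ((2^-1 * expR (- 2))%:E : \bar R) t)%E).
  rewrite integral_cst//= lebesgue_measure_itv/= lte_fin ltr1n -EFinB -EFinM lte_fin.
  by rewrite !mulr_gt0 ?expR_gt0//; lra.
apply: (@le_trans _ _ (\int[lebesgue_measure]_(t in `[1%R, 2%R])
    (t `^ (x - 1) * expR (- t))%:E)%E).
  apply: ge0_le_integral => //=.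
  - by apply/measurable_EFinP; exact: measurable_gamma_integrand.
  - move=> t; rewrite in_itv/= => /andP[t1 t2]; rewrite lee_fin.
    apply: ler_pM => //; rewrite ?expR_ge0//; last by rewrite ler_expR lerN2.
    apply: (@le_trans _ _ (t `^ (- 1))).
      rewrite powR_inv1; last lra.
      by rewrite lef_pV2// posrE; lra.
    by apply: ler_powR => //; lra.
apply: ge0_subset_integral => //.
- by apply/measurable_EFinP; exact: measurable_gamma_integrand.
- by move=> t _; rewrite lee_fin mulr_ge0 ?powR_ge0 ?expR_ge0.
- by move=> t /=; rewrite !in_itv/= andbT => /andP[t1 _]; lra.
Qed.

Lemma Gamma_gt0E (R : realType) (x : R) : 0 < x -> Gamma x = euler_integral x.
Proof.
move=> x0; rewrite /Gamma (_ : Num.truncn (1 - x) = 0%N).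
  by rewrite big_ord0 divr1 addr0.
by apply/eqP; rewrite eqn0Ngt truncn_gt0 -ltNge; lra.
Qed.

Lemma Gamma_gt0 (R : realType) (x : R) : 0 < x -> 0 < Gamma x.
Proof. by move=> x0; rewrite Gamma_gt0E// euler_integral_gt0. Qed.

Lemma GammaD1 (R : realType) (x : R) : 0 < x -> Gamma (x + 1) = x * Gamma x.
Proof.
move=> x0; rewrite !Gamma_gt0E ?addr_gt0//.
by rewrite -[LHS]/(fine (gamma_int (x + 1))) gamma_intD1// fineM ?gamma_int_fin_num.
Qed.

(** * Convolutions and backward differences of sequences *)

Definition conv (R : pzRingType) (u v : nat -> R) (m : nat) : R :=
  \sum_(j < m.+1) u j * v (m - j)%N.

(** The coefficients of [1 - z] times the generating series of [u]; thus [u] counts as [0] before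
    index [0]. *)
Definition bdiff (R : pzRingType) (u : nat -> R) (n : nat) : R :=
  if n is m.+1 then u m.+1 - u m else u 0%N.

Lemma convC (R : comPzRingType) (u v : nat -> R) (m : nat) :
  conv u v m = conv v u m.
Proof.
rewrite /conv (reindex_inj rev_ord_inj); apply: eq_bigr => j _ /=.
by rewrite subSS mulrC subKn// leq_ord.
Qed.

(** The factor [1 - z] of a product of series may be moved onto either factor, here onto [v]. *)
Lemma conv_bdiff (R : pzRingType) (u v : nat -> R) (m : nat) :
  conv u v m.+1 - conv u v m = conv u (bdiff v) m.+1.
Proof.
rewrite /conv big_ord_recr [in RHS]big_ord_recr/= subnn addrAC; congr (_ + _).
rewrite -sumrB; apply: eq_bigr => j _ /=.
by rewrite (subSn (leq_ord j))/= mulrBr.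
Qed.

(** The recurrence makes [w] the coefficients of [(1 - z)^(- nu)] up to the factor [w 0]. Of the two
    differences taken of the convolution, one goes to [g] and one to [w]. *)
Lemma bdiff_ge0_of_conv (R : realFieldType) (nu : R) (w g : nat -> R) :
  nu < 1 -> (forall i, 0 < w i) ->
  (forall i, w i.+1 * i.+1%:R = w i * (nu + i%:R)) ->
  (forall m, 0 <= conv w g m - 2 * conv w g m.+1 + conv w g m.+2) ->
  0 <= g 0%N -> g 0%N <= g 1%N -> forall k, 0 <= bdiff g k.
Proof.
move=> nu1 w_gt0 wS second_ge0 g0 g01 k.
(* The ratio of consecutive weights is [(nu + i) / (i + 1) < 1]. *)
have bdiff_w_le0 i : bdiff w i.+1 <= 0.
  rewrite /= subr_le0 -(ler_pM2r (ltr0Sn R i)) wS ler_pM2l//.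
  by rewrite -natr1; lra.
elim/ltn_ind: k => -[|[|k]] IH //=; first by rewrite subr_ge0.
have := second_ge0 k.
have -> : conv w g k - 2 * conv w g k.+1 + conv w g k.+2 =
    conv (bdiff g) (bdiff w) k.+2.
  by rewrite -conv_bdiff -!(convC w) -!conv_bdiff; ring.
(* The last term is [bdiff g k.+2 * w 0]; in the others [bdiff w] has a positive index and [bdiff g]
   is covered by induction. *)
rewrite /conv big_ord_recr/= subnn /=.
set s := \sum_(_ < _) _ => sum_ge0.
have s_le0 : s <= 0.
  apply: sumr_le0 => j _; rewrite (subSn (leq_ord j)).
  by apply: mulr_ge0_le0 => //; exact: IH.
rewrite -(pmulr_lge0 _ (w_gt0 0%N)); lra.
Qed.

(** * The fractional sum and difference as convolutions *)

(** Reindexing by [s = b - j], counting down from [b]: offset [k] from the lower end corresponds to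
    [j = m - k]. *)
Lemma sum_rangeE (R : realType) (b : R) (m : nat) (F : R -> R) :
  \sum_(s \in sum_range (b - m%:R) b) F s = \sum_(j < m.+1) F (b - j%:R).
Proof.
rewrite (fsbig_ord _ m.+1 (fun j => F (b - j%:R))).
rewrite -(fsbig_image _ (fun j : nat => b - j%:R)); last first.
  move=> i j _ _ /eqP; rewrite (inj_eq (addrI _)) eqr_opp eqr_nat.
  by move/eqP.
apply: eq_fsbigl; apply/seteqP; split => s /=.
- move=> [[k ->]]; rewrite -addrA gerDl addrC subr_le0 ler_nat => km.
  exists (m - k)%N; first by rewrite /= ltnS leq_subr.
  by rewrite natrB//; ring.
- move=> [j /=]; rewrite ltnS => jm <-; split; last by rewrite gerBl.
  by exists (m - j)%N; rewrite natrB//; ring.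
Qed.

(** The coefficient of [z^i] in [(1 - z)^(- nu)]: a rising factorial of [nu] over [i!], when
    [0 < nu]. *)
Definition sum_weight (R : realType) (nu : R) (i : nat) : R :=
  Gamma (nu + i%:R) / (Gamma nu * Gamma (i%:R + 1)).

Lemma sum_weight_gt0 (R : realType) (nu : R) (i : nat) :
  0 < nu -> 0 < sum_weight nu i.
Proof.
move=> nu0; have i0 := ler0n R i.
apply: divr_gt0; last apply: mulr_gt0; apply: Gamma_gt0; lra.
Qed.

Lemma sum_weightS (R : realType) (nu : R) (i : nat) : 0 < nu ->
  sum_weight nu i.+1 * i.+1%:R = sum_weight nu i * (nu + i%:R).
Proof.
move=> nu0; have nui0 : 0 < nu + i%:R by rewrite ltr_wpDr.
have i0 : 0 < i%:R + 1 :> R by rewrite ltr_wpDl.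
rewrite /sum_weight -natr1 addrA (GammaD1 nui0) (GammaD1 i0).
have G0 : Gamma nu != 0 by rewrite gt_eqF ?Gamma_gt0.
have Gi0 : Gamma (i%:R + 1 : R) != 0 by rewrite gt_eqF ?Gamma_gt0.
by field; rewrite G0 Gi0 gt_eqF.
Qed.

Lemma delta_right_sumE (R : realType) (b nu : R) (f : R -> R) (m : nat) :
  delta_right_sum b nu f (b - nu - m%:R) =
  conv (sum_weight nu) (fun j => f (b - j%:R)) m.
Proof.
rewrite convC /delta_right_sum.
have -> : b - nu - m%:R + nu = b - m%:R by ring.
rewrite sum_rangeE mulr_sumr; apply: eq_bigr => j _.
rewrite /falling /sigma /sum_weight natrB ?leq_ord//.
(* With [s = b - j], these are the [Gamma] arguments of the falling function, as in
   [sum_weight nu (m - j)]. *)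
have -> : b - j%:R - (b - nu - m%:R + 1) + 1 = nu + (m%:R - j%:R) by ring.
have -> : nu + (m%:R - j%:R) - (nu - 1) = m%:R - j%:R + 1 by ring.
by rewrite (invfM (Gamma nu)); ring.
Qed.

(** Here [n = 2], so the sign is [1]; lowering [t] by [1] raises the index [m] by [1]. *)
Lemma delta_right_diffE (R : realType) (b alpha : R) (f : R -> R) (m : nat) :
  1 <= alpha < 2 ->
  let S := conv (sum_weight (2 - alpha)) (fun j => f (b - j%:R)) in
  delta_right_diff b alpha f (b - (2 - alpha) - m%:R) =
  S m - 2 * S m.+1 + S m.+2.
Proof.
move=> /andP[alpha1 alpha2] S.
have trunc_alpha : Num.truncn alpha = 1%N.
  by apply/eqP; rewrite truncn_eq ?(le_trans ler01)// alpha1.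
rewrite /delta_right_diff trunc_alpha /= /nabla.
have sub1 (k : nat) : b - (2 - alpha) - k%:R - 1 = b - (2 - alpha) - k.+1%:R.
  by rewrite -natr1; ring.
by rewrite !sub1 !delta_right_sumE -/S; ring.
Qed.

Theorem theorem4p3 (R : realType) (b alpha : R) (f : R -> R)
    (alpha_gt1 : 1 < alpha) (alpha_lt2 : alpha < 2)
    (diff_ge0 : forall u : R, lowerN (b - (2 - alpha)) u ->
       0 <= delta_right_diff b alpha f u)
    (init : forall k : nat,
       f (b - 1) >= alpha / (k%:R + 1) * f b /\ alpha / (k%:R + 1) * f b >= 0) :
  forall t : R, lowerN (b - 1) t -> 0 <= - nabla f t.
Proof.
move=> _ [k ->].
(* At [k = 0] the factor is [alpha]: [0 <= alpha * f b <= f (b - 1)]. *)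
have := init 0%N; rewrite add0r divr1 => -[fb1 fb].
have fb0 : 0 <= f b by rewrite -(pmulr_rge0 _ (lt_trans ltr01 alpha_gt1)).
pose g j := f (b - j%:R).
(* At [t = b - 1 - k], [- nabla f t] is [g k.+2 - g k.+1]. *)
have g_ge0 : 0 <= bdiff g k.+2.
  apply: (@bdiff_ge0_of_conv R (2 - alpha) (sum_weight (2 - alpha))).
  - lra.
  - by move=> i; apply: sum_weight_gt0; lra.
  - by move=> i; apply: sum_weightS; lra.
  - move=> m; rewrite -delta_right_diffE ?(ltW alpha_gt1)//.
    by apply: diff_ge0; exists m.
  - by rewrite /g subr0.
  (* [f b <= alpha * f b] because [1 < alpha] and [0 <= f b]. *)
  - rewrite /g subr0; apply: le_trans fb1.
    by rewrite ler_peMl// ltW.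
move: g_ge0; rewrite /= /g /nabla.
have -> : b - 1 - k%:R = b - k.+1%:R by rewrite -natr1; ring.
have -> : b - k.+1%:R - 1 = b - k.+2%:R by rewrite -(natr1 k.+1); ring.
lra.
Qed.
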